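(* Let $f:\mathbb R^6\to\mathbb R$ be a smooth function and let $\omega^f$ be the differential three-form on $\mathbb R^6$ given by $$\omega^f= dx^{135} -dx^{146}-dx^{236} + f(x)\cdot dx^{245}.$$ If $f$ depends only on $x_2,x_4$ and $x_5$, then the manifold $\mathbb R^6$ equipped with $\omega^f$ is multisymplectic of degree $3$. For $p\in\mathbb R^6$, the form $\omega^f_p$ has the linear type of $\alpha_{(i)}$ if $f(p)>0$, of $\alpha_{(ii)}$ if $f(p)<0$, and of $\alpha_{(iii)}$ if $f(p)=0$, where \begin{align*} &\alpha_{(i)}=e^1\wedge e^2\wedge e^3+ e^4\wedge e^5\wedge e^6,\\ &\alpha_{(ii)}=e^1\wedge e^3\wedge e^5 - e^1\wedge e^4\wedge e^6 - e^2\wedge e^3\wedge e^6-e^2\wedge e^4\wedge e^5,\\ &\alpha_{(iii)}=e^1\wedge e^5\wedge e^6 - e^2\wedge e^4\wedge e^6 + e^3\wedge e^4\wedge e^5, \end{align*} and $\{e^1,\dots,e^6\}$ is an ordered basis of the dual of a six-dimensional real vector space (e.g. the standard basis of $(\mathbb R^6)^*$).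
   Context: $x_1,\dots,x_6$ are the standard coordinates on $\mathbb R^6$ and $dx^{ijk}$ denotes $dx^i\wedge dx^j\wedge dx^k$. On a finite-dimensional real vector space $V$, a form $\alpha\in\Lambda^kV^*$ is called non-degenerate if the map $V\to\Lambda^{k-1}V^*$, $v\mapsto\iota_v\alpha$, is injective. Two vector spaces of the same dimension with non-degenerate $k$-forms $(V,\alpha)$, $(\tilde V,\tilde\alpha)$ have the same linear type if there exists a linear isomorphism $\psi:V\to\tilde V$ with $\psi^*\tilde\alpha=\alpha$. A smooth manifold $M$ equipped with a closed differential form $\omega\in\Omega^k_{cl}(M)$ is called multisymplectic of degree $k$ if $\omega_p\in\Lambda^kT_p^*M$ is non-degenerate for all $p\in M$. *)

(* Defs.v *)
From HB Require Import structures.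
From mathcomp Require Import all_boot all_order all_algebra.
From mathcomp Require Import all_classical all_reals all_analysis.
Set Implicit Arguments.
Unset Strict Implicit.
Unset Printing Implicit Defensive.
Import Order.TTheory GRing.Theory Num.Theory.
Import numFieldNormedType.Exports.
Local Open Scope ring_scope.

Section AlternatingForms.
Context {R : realType}.

Definition update (V : Type) k (w : 'I_k -> V) (i : 'I_k) (u : V) : 'I_k -> V :=
  fun j => if j == i then u else w j.

Definition multilinear (V : vectType R) k (f : ('I_k -> V) -> R^o) : Prop :=
  forall (i : 'I_k) (w : 'I_k -> V), linear (fun u : V => f (update w i u)).

Definition alternating (V : vectType R) k (f : ('I_k -> V) -> R^o) : Prop :=
  forall (i j : 'I_k) (w : 'I_k -> V), i != j -> w i = w j -> f w = 0.

Definition is_altform (V : vectType R) k : {pred (('I_k -> V) -> R^o)} :=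
  fun f => `[< multilinear f /\ alternating f >].

(* [altform V k] is the space of alternating k-linear forms on V, with the
   vector space operations of functions ('I_k -> V) -> R. *)
Record altform (V : vectType R) (k : nat) := AltForm {
  altform_fun :> ('I_k -> V) -> R^o;
  altformP : altform_fun \in @is_altform V k }.

HB.instance Definition _ (V : vectType R) k := [isSub for @altform_fun V k].
HB.instance Definition _ (V : vectType R) k := [Choice of altform V k by <:].

Lemma is_altform_submod_closed (V : vectType R) k :
  submod_closed (@is_altform V k).
Proof.
split=> [|a f g /asboolP[fl fa] /asboolP[gl ga]]; apply/asboolP; split.
- by move=> i w b u v; rewrite /= scaler0 addr0.
- by [].
- move=> i w b u v.
  have Hf := fl i w b u v; have Hg := gl i w b u v.
  rewrite /= in Hf Hg *.
  change (a *: f (update w i (b *: u + v)) + g (update w i (b *: u + v)) =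
   b *: (a *: f (update w i u) + g (update w i u)) +
   (a *: f (update w i v) + g (update w i v))).
  rewrite Hf Hg !scalerDr !scalerA [b * a]mulrC -!addrA; congr (_ + _).
  by rewrite addrCA.
- move=> i j w ij wij.
  change (a *: f w + g w = 0).
  by rewrite (fa _ _ _ ij wij) (ga _ _ _ ij wij) scaler0 addr0.
Qed.
HB.instance Definition _ (V : vectType R) k := GRing.isSubmodClosed.Build R
  (('I_k -> V) -> R^o) (@is_altform V k) (@is_altform_submod_closed V k).
HB.instance Definition _ (V : vectType R) k :=
  [SubChoice_isSubLmodule of altform V k by <:].

Definition vcons (V : Type) k (v : V) (w : 'I_k -> V) : 'I_k.+1 -> V :=
  fun i => if unlift ord0 i is Some j then w j else v.

Lemma contract_subproof (V : vectType R) k (a : altform V k.+1) (v : V) :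
  (fun w : 'I_k -> V => a (vcons v w)) \in @is_altform V k.
Proof.
have /asboolP[al aa] := altformP a; apply/asboolP; split.
- have E i w u : vcons v (update w i u) = update (vcons v w) (lift ord0 i) u.
    apply/funext => j; rewrite /vcons /update.
    by case: unliftP => [j' ->|->] //; rewrite (inj_eq lift_inj).
  by move=> i w b u1 u2; rewrite /= !E; exact: al.
- move=> i j w ij wij; apply: (aa (lift ord0 i) (lift ord0 j)).
    by rewrite (inj_eq lift_inj).
  by rewrite /vcons !liftK.
Qed.
Definition contract (V : vectType R) k (v : V) (a : altform V k.+1) :
  altform V k := AltForm (contract_subproof a v).

Definition nondegenerate (V : vectType R) k (a : altform V k.+1) : Prop :=
  injective (fun v : V => contract v a).

Lemma pullback_subproof (V W : vectType R) k (psi : 'Hom(V, W))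
    (b : altform W k) :
  (fun w : 'I_k -> V => b (psi \o w)) \in @is_altform V k.
Proof.
have /asboolP[bl ba] := altformP b; apply/asboolP; split.
- have E i w u : psi \o update w i u = update (psi \o w) i (psi u).
    by apply/funext => j; rewrite /update /=; case: ifP.
  by move=> i w c u1 u2; rewrite /= !E linearP; exact: bl.
- by move=> i j w ij wij; apply: (ba i j) => //=; rewrite wij.
Qed.
Definition pullback (V W : vectType R) k (psi : 'Hom(V, W)) (b : altform W k) :
  altform V k := AltForm (pullback_subproof psi b).

(* The linear type is a notion for non-degenerate forms only, so their
   non-degeneracy is part of the relation. *)
Definition same_linear_type (V W : vectType R) k
    (a : altform V k.+1) (b : altform W k.+1) : Prop :=
  [/\ nondegenerate a, nondegenerate b &
      exists psi : 'Hom(V, W), bijective psi /\ pullback psi b = a].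

Lemma wedge_subproof (V : vectType R) k (phi : k.-tuple 'Hom(V, R^o)) :
  (fun w : 'I_k -> V => \det (\matrix_(i, j) (tnth phi j (w i) : R)) : R^o)
    \in @is_altform V k.
Proof.
apply/asboolP; split.
- move=> i w b u1 u2; rewrite /GRing.scale /= -[X in _ = _ + X]mul1r.
  apply: (determinant_multilinear (i0 := i)).
  + apply/rowP => j; rewrite !mxE /update eqxx linearP /=.
    by rewrite mul1r.
  + by apply/matrixP => x y; rewrite !mxE /update eq_sym (negPf (neq_lift _ _)).
  + by apply/matrixP => x y; rewrite !mxE /update eq_sym (negPf (neq_lift _ _)).
- move=> i j w ij wij; apply: (determinant_alternate ij) => x.
  by rewrite !mxE wij.
Qed.

(* phi_1 /\ ... /\ phi_k for covectors phi_i, with the normalization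
   (phi_1 /\ ... /\ phi_k)(w_1, ..., w_k) = det (phi_j (w_i)). *)
Definition wedge (V : vectType R) k (phi : k.-tuple 'Hom(V, R^o)) :
  altform V k := AltForm (wedge_subproof phi).

(* e^i /\ e^j /\ e^k; the indices i, j, k are counted from 1. *)
Definition wedge3 (V : vectType R) n (e : n.-tuple 'Hom(V, R^o))
    (i j k : nat) : altform V 3 :=
  wedge [tuple e`_i.-1; e`_j.-1; e`_k.-1].

Definition alpha_i (V : vectType R) (e : 6.-tuple 'Hom(V, R^o)) :
    altform V 3 :=
  wedge3 e 1 2 3 + wedge3 e 4 5 6.

Definition alpha_ii (V : vectType R) (e : 6.-tuple 'Hom(V, R^o)) :
    altform V 3 :=
  wedge3 e 1 3 5 - wedge3 e 1 4 6 - wedge3 e 2 3 6 - wedge3 e 2 4 5.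

Definition alpha_iii (V : vectType R) (e : 6.-tuple 'Hom(V, R^o)) :
    altform V 3 :=
  wedge3 e 1 5 6 - wedge3 e 2 4 6 + wedge3 e 3 4 5.

End AlternatingForms.

Section DifferentialForms.
Context {R : realType}.

(* C^oo: all iterated directional derivatives D_{v_1} ... D_{v_r} f, r >= 0,
   are (Frechet) differentiable everywhere. *)
Definition smooth n (f : 'rV[R]_n.+1 -> R^o) : Prop :=
  forall (vs : seq 'rV[R]_n.+1) (p : 'rV[R]_n.+1),
    differentiable (foldr (fun v g => fun x => 'D_v g x) f vs) p.

(* f depends only on the coordinates x_i, i in s, counted from 1. *)
Definition depends_only_on n (s : seq nat) (f : 'rV[R]_n -> R^o) : Prop :=
  forall x y : 'rV[R]_n,
    (forall i : 'I_n, i.+1 \in s -> x 0 i = y 0 i) -> f x = f y.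

(* A k-form on R^n, every tangent space being identified with R^n. *)
Definition form n k := 'rV[R]_n.+1 -> altform 'rV[R]_n.+1 k.

(* Coefficients with respect to constant vector fields are smooth. *)
Definition smooth_form n k (om : form n k) : Prop :=
  forall w : 'I_k -> 'rV[R]_n.+1, smooth (fun p => om p w).

(* The value of d(om) at p on v_0, ..., v_k. This is the invariant formula for
   d evaluated on constant vector fields, whose brackets vanish. *)
Definition extd n k (om : form n k) (p : 'rV[R]_n.+1)
    (v : 'I_k.+1 -> 'rV[R]_n.+1) : R^o :=
  \sum_(i < k.+1)
    (-1) ^+ i * 'D_(v i) (fun x => om x (fun j => v (lift i j)) : R^o) p.

Definition closed_form n k (om : form n k) : Prop :=
  forall p v, extd om p v = 0.

(* R^n equipped with om is multisymplectic of degree k.+1. *)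
Definition multisymplectic n k (om : form n k.+1) : Prop :=
  [/\ smooth_form om, closed_form om & forall p, nondegenerate (om p)].

Definition coordinate n (i : 'I_n) : 'rV[R]_n -> R^o := fun v => v 0 i.

Lemma coordinate_is_linear n (i : 'I_n) : linear (coordinate i).
Proof. by move=> a u v; rewrite /coordinate !mxE. Qed.
HB.instance Definition _ n (i : 'I_n) :=
  GRing.isLinear.Build R 'rV[R]_n R^o *:%R (coordinate i)
    (coordinate_is_linear i).

(* dx^1, ..., dx^n, at an arbitrary point. *)
Definition dx n : n.-tuple 'Hom('rV[R]_n, R^o) :=
  [tuple linfun (coordinate i) | i < n].

Definition omega_f (f : 'rV[R]_6 -> R^o) : form 5 3 := fun x =>
  wedge3 (dx 6) 1 3 5 - wedge3 (dx 6) 1 4 6 - wedge3 (dx 6) 2 3 6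
  + f x *: wedge3 (dx 6) 2 4 5.

End DifferentialForms.

(* Main.v *)
Require Import Defs.
From HB Require Import structures.
From mathcomp Require Import all_boot all_order all_algebra.
From mathcomp Require Import all_classical all_reals all_analysis.
From mathcomp Require Import ring.
Import Order.TTheory GRing.Theory Num.Theory.
Import numFieldNormedType.Exports.
Local Open Scope ring_scope.

(** The form omega^f is a constant form plus f dx^{245}. Hence it is smooth
    when f is, and d omega^f = df /\ dx^{245}; if f depends only on x_2, x_4,
    x_5 then df is a combination of dx^2, dx^4, dx^5, so this vanishes
    ([omega_f_closed]). Non-degeneracy holds whatever the value of f: among the
    components of iota_v omega^f that do not involve f one finds every
    coordinate of v up to sign ([omega_f_nondegenerate]).

    For the linear types, fix p, write c = f p, and look for covectors
    eta^1, ..., eta^6 on R^6 in which omega^f_p takes the shape of one of the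
    alphas.
    - If c < 0, put s = sqrt (- c) and take s dx^2, s dx^4, dx^6 / s in place
      of dx^2, dx^4, dx^6: the coefficient of the 245 term becomes -1 and the
      other terms are preserved.
    - If c > 0, the same rescaling with s = sqrt c makes that coefficient 1.
      In the rescaled covectors y^i the form is the real part of the wedge
      product (y^1 + j y^2)(y^3 + j y^4)(y^5 - j y^6) over the split-complex
      numbers, j^2 = 1. The idempotents (1 + j)/2 and (1 - j)/2 split it as
      half of
      (y^1 + y^2)(y^3 + y^4)(y^5 - y^6) + (y^1 - y^2)(y^3 - y^4)(y^5 + y^6).
    - If c = 0, relabelling the dx^i up to sign is enough: each of dx^1, dx^3,
      dx^6 occurs in two of the three remaining terms, as each of e^4, e^5,
      e^6 does in alpha_iii.

    Since e is a basis of V^*, there is a linear map psi : R^6 -> V with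
    e^i o psi = eta^i ([basis_realizes_covectors]), and so it pulls the alpha
    built on e back to omega^f_p. There is no need to verify that the eta^i are
    linearly independent: a linear map whose pullback of some form is
    non-degenerate must be injective ([pullback_nondegenerate_injective]),
    hence bijective by dimension, and the non-degeneracy of omega^f_p then
    passes to alpha ([same_linear_type_of_pullback]). *)

Section LinearAlgebra.
Context {R : realType}.

(** * Pullbacks and the linear type *)

Lemma injective_bijective (V W : vectType R) (g : 'Hom(V, W)) :
  \dim {:V} = \dim {:W} -> injective g -> bijective g.
Proof.
move=> dVW /lker0P k0.
have img : limg g = fullv.
  apply/eqP; rewrite eqEdim subvf limg_dim_eq.
    by rewrite -dVW leqnn.
  by rewrite (eqP k0) capv0.
exists g^-1%VF; first exact: lker0_lfunK.
by move=> x; apply: limg_lfunVK; rewrite img memvf.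
Qed.

Lemma comp_vcons (V W : Type) k (g : V -> W) (v : V) (w : 'I_k -> V) :
  g \o vcons v w = vcons (g v) (g \o w).
Proof. by apply/funext => i; rewrite /vcons /=; case: unlift. Qed.

Lemma contract_pullback (V W : vectType R) k (psi : 'Hom(V, W))
    (b : altform W k.+1) (v : V) :
  Defs.contract v (pullback psi b) = pullback psi (Defs.contract (psi v) b).
Proof.
apply/val_inj/funext => w; rewrite /=.
by rewrite comp_vcons.
Qed.

Lemma pullback_nondegenerate_injective (V W : vectType R) k
    (psi : 'Hom(V, W)) (b : altform W k.+1) :
  Defs.nondegenerate (pullback psi b) -> injective psi.
Proof. by move=> nd u v uv; apply: nd; rewrite !contract_pullback uv. Qed.

Lemma nondegenerate_of_pullback (V W : vectType R) k (psi : 'Hom(V, W))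
    (b : altform W k.+1) :
  bijective psi -> Defs.nondegenerate (pullback psi b) -> Defs.nondegenerate b.
Proof.
move=> [psi' K K'] nd u v uv.
rewrite -(K' u) -(K' v); congr (psi _); apply: nd.
by rewrite /= !contract_pullback !K' uv.
Qed.

Lemma same_linear_type_of_pullback (V W : vectType R) k (psi : 'Hom(V, W))
    (a : altform V k.+1) (b : altform W k.+1) :
  \dim {:V} = \dim {:W} -> Defs.nondegenerate a -> pullback psi b = a ->
  same_linear_type a b.
Proof.
move=> dVW + E; rewrite -E => nd.
have psi_bij := injective_bijective _ _ _ dVW
  (pullback_nondegenerate_injective _ _ _ _ _ nd).
by split=> //; [exact: nondegenerate_of_pullback nd | exists psi].
Qed.

(** * Linear maps with prescribed coordinates *)

Definition coframe_map (V : vectType R) (n : nat) (e : n.-tuple 'Hom(V, R^o))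
  (v : V) : 'rV[R]_n := \row_i tnth e i v.

Lemma coframe_map_linear (V : vectType R) n e : linear (@coframe_map V n e).
Proof. by move=> c u v; apply/rowP => i; rewrite !mxE linearP. Qed.

HB.instance Definition _ (V : vectType R) n e :=
  GRing.isLinear.Build R V 'rV[R]_n *:%R (@coframe_map V n e)
    (@coframe_map_linear V n e).

Lemma basis_separates (V : vectType R) n (e : n.-tuple 'Hom(V, R^o)) (v : V) :
  basis_of fullv e -> (forall i, tnth e i v = 0) -> v = 0.
Proof.
move=> be e0.
have all0 (phi : 'Hom(V, R^o)) : phi v = 0.
  rewrite (coord_basis be (memvf phi)) sum_lfunE big1 // => i _.
  by rewrite scale_lfunE -tnth_nth e0 scaler0.
rewrite (coord_vbasis (memvf v)) big1 // => i _.
have := all0 (linfun (coord (vbasis fullv) i)).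
by rewrite lfunE /= => ->; rewrite scale0r.
Qed.

(** The coordinates of a vector in the coframe e are arbitrary, so covectors
    eta on V are the coordinates of a map into W. *)
Lemma basis_realizes_covectors (V W : vectType R) n
    (e : n.-tuple 'Hom(W, R^o)) (eta : n.-tuple 'Hom(V, R^o)) :
  \dim {:W} = n -> basis_of fullv e ->
  exists psi : 'Hom(V, W),
    forall i v, (e : seq _)`_i (psi v) = (eta : seq _)`_i v.
Proof.
move=> dW be; pose E := linfun (coframe_map _ n e).
have dWr : \dim {:W} = \dim {:'rV[R]_n} by rewrite dW dimvf /dim /= mul1n.
have E_inj : injective E.
  move=> x y Exy; apply/subr0_eq/(basis_separates _ _ _ _ be) => i.
  move: Exy; rewrite !lfunE /= => /rowP/(_ i); rewrite !mxE linearB /= => ->.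
  exact: subrr.
have [E' _ EK] := injective_bijective _ _ E dWr E_inj.
have {}EK : cancel E^-1%VF E.
  by move=> x; apply: limg_lfunVK; rewrite -(EK x) memv_img ?memvf.
exists (E^-1 \o linfun (coframe_map _ n eta))%VF => i v.
(* Beyond the length of the tuples both sides are the default covector 0. *)
have [ni|ni] := leqP n i; first by rewrite !nth_default ?size_tuple // !lfunE.
have := congr1 (fun x : 'rV_n => x 0 (Ordinal ni)) (EK (coframe_map _ n eta v)).
by rewrite /E comp_lfunE !lfunE /= !mxE !(tnth_nth 0).
Qed.

(** * Three-forms in coordinates *)

(** The determinant of rows i, j, k and columns 0, 1, 2 of X. *)
Definition minor3 (X : nat -> nat -> R) (i j k : nat) : R :=
  X i 0%N * (X j 1%N * X k 2%N - X j 2%N * X k 1%N)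
  - X i 1%N * (X j 0%N * X k 2%N - X j 2%N * X k 0%N)
  + X i 2%N * (X j 0%N * X k 1%N - X j 1%N * X k 0%N).

Lemma wedge3E (V : vectType R) n (e : n.-tuple 'Hom(V, R^o))
    (i j k : nat) (w : 'I_3 -> V) :
  wedge3 e i j k w =
  minor3 (fun l m => (e : seq _)`_l.-1 (w (inord m))) i j k.
Proof.
have -> : w = (fun m : 'I_3 => w (inord m)).
  by apply/funext => m; rewrite inord_val.
rewrite /wedge3 /wedge /minor3 /=.
rewrite (expand_det_col _ ord0) !big_ord_recl big_ord0 /cofactor.
rewrite !(expand_det_col _ ord0) !big_ord_recl !big_ord0 /cofactor !det_mx11.
rewrite !mxE /= !(tnth_nth 0) /= !inordK // /bump /=.
by ring.
Qed.

Lemma pullback_wedge3 (V W : vectType R) m n (psi : 'Hom(V, W))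
    (e : m.-tuple 'Hom(W, R^o)) (eta : n.-tuple 'Hom(V, R^o)) i j k w :
  (forall i v, (e : seq _)`_i (psi v) = (eta : seq _)`_i v) ->
  wedge3 e i j k (psi \o w) = wedge3 eta i j k w.
Proof. by move=> h; rewrite !wedge3E /minor3 !h. Qed.

Lemma dxE n l (x : 'rV[R]_n.+1) :
  (l <= n)%N -> ((dx n.+1) : seq _)`_l x = x 0 (inord l).
Proof.
move=> ln; have := tnth_nth 0 (dx n.+1) (inord l).
by rewrite inordK // => <-; rewrite tnth_mktuple lfunE.
Qed.

Lemma omega_fE (f : 'rV[R]_6 -> R^o) p (w : 'I_3 -> 'rV[R]_6) :
  let d := minor3 (fun l m => w (inord m) 0 (inord l.-1)) in
  omega_f f p w = d 1 3 5 - d 1 4 6 - d 2 3 6 + f p * d 2 4 5.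
Proof.
have E i j k : (i.-1 <= 5)%N -> (j.-1 <= 5)%N -> (k.-1 <= 5)%N ->
    wedge3 (dx 6) i j k w =
    minor3 (fun l m => w (inord m) 0 (inord l.-1)) i j k.
  by move=> i5 j5 k5; rewrite wedge3E /minor3 !dxE.
change (omega_f f p w) with (wedge3 (dx 6) 1 3 5 w - wedge3 (dx 6) 1 4 6 w
  - wedge3 (dx 6) 2 3 6 w + f p * wedge3 (dx 6) 2 4 5 w).
by rewrite !E.
Qed.

(** * Non-degeneracy of omega^f *)

Lemma vcons0 (V : Type) k (v : V) (w : 'I_k -> V) : vcons v w (inord 0) = v.
Proof.
rewrite /vcons; case: unliftP => // j /(congr1 val).
by rewrite /= inordK.
Qed.

Lemma vconsS (V : Type) k (v : V) (w : 'I_k.+1 -> V) m :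
  (m <= k)%N -> vcons v w (inord m.+1) = w (inord m).
Proof.
move=> mk; rewrite /vcons.
case: unliftP => [j|] /(congr1 val); rewrite /= inordK // ?ltnS //.
by move=> [->]; rewrite inord_val.
Qed.

Definition basis_pair (a b : nat) (m : 'I_2) : 'rV[R]_6 :=
  delta_mx 0 (inord (if m == 0 :> nat then a else b).-1).

Lemma omega_f_contract (f : 'rV[R]_6 -> R^o) p u a b :
  (0 < a <= 6)%N -> (0 < b <= 6)%N ->
  omega_f f p (vcons u (basis_pair a b)) =
  let d := minor3 (fun l m =>
    nth 0 [:: u 0 (inord l.-1); (l == a)%:R; (l == b)%:R] m) in
  d 1 3 5 - d 1 4 6 - d 2 3 6 + f p * d 2 4 5.
Proof.
move=> a6 b6; rewrite omega_fE.
have E l : (0 < l <= 6)%N ->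
  (vcons u (basis_pair a b) (inord 0) 0 (inord l.-1) = u 0 (inord l.-1)) *
  (vcons u (basis_pair a b) (inord 1) 0 (inord l.-1) = (l == a)%:R) *
  (vcons u (basis_pair a b) (inord 2) 0 (inord l.-1) = (l == b)%:R).
  by move=> l6; rewrite vcons0 !vconsS // !mxE /= -!val_eqE /= !inordK //;
    move: a6 b6 l6; case: l a b => [|l] [|a] [|b].
by rewrite /minor3 !E.
Qed.

(** The components 35, 36, 15, 16, 13, 14 of the contraction with v are
    v_1, - v_2, - v_3, v_4, v_5, - v_6. *)
Lemma omega_f_nondegenerate (f : 'rV[R]_6 -> R^o) p :
  Defs.nondegenerate (omega_f f p).
Proof.
move=> u v uv.
have H a b : omega_f f p (vcons u (basis_pair a b)) =
             omega_f f p (vcons v (basis_pair a b)).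
  exact: (congr1 (fun al : altform _ 2 => al (basis_pair a b)) uv).
have := H 3%N 5%N; rewrite !omega_f_contract // /minor3 /=.
rewrite !(mulr0, mulr1, mul0r, mul1r, subr0, sub0r, add0r, addr0, oppr0) => h1.
have := H 3%N 6%N; rewrite !omega_f_contract // /minor3 /=.
rewrite !(mulr0, mulr1, mul0r, mul1r, subr0, sub0r, add0r, addr0, oppr0).
move=> /oppr_inj h2.
have := H 1%N 5%N; rewrite !omega_f_contract // /minor3 /=.
rewrite !(mulr0, mulr1, mul0r, mul1r, subr0, sub0r, add0r, addr0, oppr0).
move=> /oppr_inj h3.
have := H 1%N 6%N; rewrite !omega_f_contract // /minor3 /=.
rewrite !(mulr0, mulr1, mul0r, mul1r, subr0, sub0r, add0r, addr0, oppr0).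
move=> /oppr_inj/oppr_inj h4.
have := H 1%N 3%N; rewrite !omega_f_contract // /minor3 /=.
rewrite !(mulr0, mulr1, mul0r, mul1r, subr0, sub0r, add0r, addr0, oppr0).
move=> /oppr_inj/oppr_inj h5.
have := H 1%N 4%N; rewrite !omega_f_contract // /minor3 /=.
rewrite !(mulr0, mulr1, mul0r, mul1r, subr0, sub0r, add0r, addr0, oppr0).
move=> /oppr_inj/oppr_inj/oppr_inj h6.
apply/rowP => i; rewrite -(inord_val i).
by case: i => [[|[|[|[|[|[|?]]]]]] ?] //=.
Qed.

(** * Smoothness and closedness of omega^f *)

Lemma derive_affine n (f : 'rV[R]_n.+1 -> R^o) (c d : R) p v :
  differentiable f p ->
  'D_v (fun x => c + d * f x : R^o) p = d * 'D_v f p.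
Proof.
move=> df.
change ('D_v (cst (c : R^o) + (d \*: f)) p = d * 'D_v f p).
rewrite deriveD; [|exact: derivable_cst|].
  by rewrite derive_cst add0r deriveZ //; exact: diff_derivable.
by apply: derivableZ; exact: diff_derivable.
Qed.

Lemma smooth_affine n (f : 'rV[R]_n.+1 -> R^o) (c d : R) :
  smooth f -> smooth (fun x => c + d * f x : R^o).
Proof.
move=> sf vs p.
(* Iterated derivatives keep the factor d; the constant is c or 0. *)
have [c' ->] : exists c' : R,
    foldr (fun v g => fun x => 'D_v g x) (fun x => c + d * f x : R^o) vs =
    (fun x => c' + d * foldr (fun v g => fun x => 'D_v g x) f vs x : R^o).
  elim: vs => [|v vs [c' IH]]; first by exists c.
  exists 0; rewrite /= IH; apply/funext => x.
  by rewrite derive_affine ?add0r //; exact: sf.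
change (differentiable (cst (c' : R^o) +
  (d \*: foldr (fun v g => fun x => 'D_v g x) f vs)) p).
apply: differentiableD; first exact: differentiable_cst.
by apply: differentiableZ; exact: sf.
Qed.

Lemma derive_indep n (s : seq nat) (f : 'rV[R]_n.+1 -> R^o)
    (p v : 'rV[R]_n.+1) :
  depends_only_on s f -> (forall i : 'I_n.+1, i.+1 \in s -> v 0 i = 0) ->
  'D_v f p = 0.
Proof.
move=> fs v0; rewrite /derive.
have -> : (fun h : R => h^-1 *: ((f \o shift p) (h *: v) - f p)) = cst 0.
  apply/funext => h; rewrite /= (fs _ p) ?subrr ?scaler0 // => i si.
  by rewrite !mxE v0 // mulr0 add0r.
exact: lim_cst.
Qed.

Lemma derive_depends_only n (s : seq nat) (f : 'rV[R]_n.+1 -> R^o)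
    (p v : 'rV[R]_n.+1) :
  uniq s -> all (fun i => 0 < i <= n.+1)%N s ->
  differentiable f p -> depends_only_on s f ->
  'D_v f p =
  \sum_(i <- s) v 0 (inord i.-1) * 'D_(delta_mx 0 (inord i.-1)) f p.
Proof.
move=> us sn df fs.
pose v' : 'rV[R]_n.+1 :=
  \sum_(i <- s) v 0 (inord i.-1) *: delta_mx 0 (inord i.-1).
have vv' : 'D_(v - v') f p = 0.
  apply: (derive_indep _ s) => // i si.
  rewrite !mxE summxE (bigD1_seq i.+1) //= !mxE eqxx inord_val eqxx mulr1.
  rewrite big_seq_cond big1 ?addr0 ?subrr // => j /andP[js ji].
  have /= := allP sn _ js; case: j ji js => // j /=; rewrite eqSS => ji _ jn.
  by rewrite !mxE eqxx /= -val_eqE /= inordK // eq_sym (negPf ji) mulr0.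
rewrite -[v in LHS](subrK v') !deriveE // linearD /= -deriveE // vv' add0r.
rewrite linear_sum; apply: eq_bigr => i _.
by rewrite linearZ /= deriveE.
Qed.

(** Reduces differentiating the coefficients of omega^f to differentiating f. *)
Lemma omega_f_affine (f : 'rV[R]_6 -> R^o) (w : 'I_3 -> 'rV[R]_6) :
  (fun p => omega_f f p w) =
  (fun p => omega_f (fun=> 0) 0 w +
    minor3 (fun l m => w (inord m) 0 (inord l.-1)) 2 4 5 * f p : R^o).
Proof.
by apply/funext => x; rewrite !omega_fE mul0r addr0 [f x * _]mulrC.
Qed.

Lemma omega_f_smooth (f : 'rV[R]_6 -> R^o) :
  smooth f -> smooth_form (omega_f f).
Proof. by move=> sf w; rewrite omega_f_affine; exact: smooth_affine. Qed.

(** The Laplace expansion of a determinant with rows 2, 4, 5 of X and a linear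
    combination of them. *)
Lemma minor3_expansion (X : nat -> nat -> R) (a b c : R) :
  \sum_(i < 4) (-1) ^+ i * (minor3 (fun l m => X l (bump i m)) 2 4 5 *
    (X 2%N i * a + (X 4%N i * b + X 5%N i * c))) = 0.
Proof. by rewrite !big_ord_recl big_ord0 /minor3 /bump /=; ring. Qed.

(** By hypothesis df is a combination of dx^2, dx^4, dx^5, so that
    df /\ dx^{245} = 0. *)
Lemma omega_f_closed (f : 'rV[R]_6 -> R^o) :
  (forall p, differentiable f p) ->
  depends_only_on [:: 2; 4; 5]%N f -> closed_form (omega_f f).
Proof.
move=> df f245 p v; rewrite /extd.
pose D l : R := 'D_(delta_mx 0 (inord l.-1)) f p.
rewrite -[RHS](minor3_expansion (fun l m => v (inord m) 0 (inord l.-1))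
  (D 2%N) (D 4%N) (D 5%N)).
apply: eq_bigr => i _; congr (_ * _).
rewrite omega_f_affine derive_affine // inord_val; congr (_ * _).
  have E m : (m < 3)%N -> lift i (inord m) = inord (bump i m).
    move=> m3; apply/val_inj; rewrite /= !inordK //.
    by rewrite /bump; case: (i <= m)%N; [exact: m3 | exact: leqW].
  by rewrite /minor3 !E.
rewrite (derive_depends_only _ [:: 2; 4; 5]%N) //.
by rewrite !big_cons big_nil addr0.
Qed.

(** * The linear type of omega^f at a point *)

Lemma omega_f_linear_type (f : 'rV[R]_6 -> R^o) p (V : vectType R)
    (e : 6.-tuple 'Hom(V, R^o)) (eta : 6.-tuple 'Hom('rV[R]_6, R^o))
    (b : altform V 3) :
  \dim {:V} = 6%N -> basis_of fullv e ->
  (forall psi : 'Hom('rV[R]_6, V),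
     (forall i v, (e : seq _)`_i (psi v) = (eta : seq _)`_i v) ->
     forall w, b (psi \o w) = omega_f f p w) ->
  same_linear_type (omega_f f p) b.
Proof.
move=> dV be b_eta.
have [psi psi_eta] := basis_realizes_covectors _ _ _ e eta dV be.
apply: (same_linear_type_of_pullback _ _ _ psi).
- by rewrite dV dimvf /dim /= mul1n.
- exact: omega_f_nondegenerate.
- by apply/val_inj/funext => w; exact: b_eta.
Qed.

(** Keeps the coordinate covectors opaque, so that simplification does not
    unfold the tuple of the dx^i. *)
Lemma coordinate_covectors :
  exists D : nat -> 'Hom('rV[R]_6, R^o),
    forall l x, (0 < l <= 6)%N -> D l x = x 0 (inord l.-1).
Proof.
exists (fun l => (dx 6 : seq _)`_l.-1) => -[|l] x // l6.
by rewrite dxE.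
Qed.

Section LinearTypes.
Context (f : 'rV[R]_6 -> R^o) (p : 'rV[R]_6) (V : vectType R).
Context (e : 6.-tuple 'Hom(V, R^o)).
Context (dV : \dim {:V} = 6%N) (be : basis_of fullv e).

Lemma linear_type_pos : 0 < f p -> same_linear_type (omega_f f p) (alpha_i e).
Proof.
move=> fp; have [D DE] := coordinate_covectors.
pose s := Num.sqrt (f p).
have s0 : s != 0 by rewrite gt_eqF // sqrtr_gt0.
have fE : f p = s ^+ 2 by rewrite sqr_sqrtr // ltW.
apply: (omega_f_linear_type f p V e
  [tuple 2^-1 *: (D 1%N + s *: D 2%N); D 3%N + s *: D 4%N;
         D 5%N - s^-1 *: D 6%N;
         2^-1 *: (D 1%N - s *: D 2%N); D 3%N - s *: D 4%N;
         D 5%N + s^-1 *: D 6%N]) => // psi h w.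
change (wedge3 e 1 2 3 (psi \o w) + wedge3 e 4 5 6 (psi \o w) =
  omega_f f p w).
rewrite !(pullback_wedge3 _ _ _ _ _ _ _ _ _ _ _ h) omega_fE !wedge3E /minor3 /=.
rewrite !(add_lfunE, opp_lfunE, scale_lfunE, DE) // /GRing.scale /= fE.
by field.
Qed.

Lemma linear_type_neg : f p < 0 -> same_linear_type (omega_f f p) (alpha_ii e).
Proof.
move=> fp; have [D DE] := coordinate_covectors.
pose s := Num.sqrt (- f p).
have s0 : s != 0 by rewrite gt_eqF // sqrtr_gt0 oppr_gt0.
have fE : f p = - s ^+ 2 by rewrite sqr_sqrtr ?opprK // oppr_ge0 ltW.
apply: (omega_f_linear_type f p V e
  [tuple D 1%N; s *: D 2%N; D 3%N; s *: D 4%N; D 5%N; s^-1 *: D 6%N])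
  => // psi h w.
change (wedge3 e 1 3 5 (psi \o w) - wedge3 e 1 4 6 (psi \o w)
  - wedge3 e 2 3 6 (psi \o w) - wedge3 e 2 4 5 (psi \o w) = omega_f f p w).
rewrite !(pullback_wedge3 _ _ _ _ _ _ _ _ _ _ _ h) omega_fE !wedge3E /minor3 /=.
rewrite !(scale_lfunE, DE) // /GRing.scale /= fE.
by field.
Qed.

Lemma linear_type_zero :
  f p = 0 -> same_linear_type (omega_f f p) (alpha_iii e).
Proof.
move=> fp; have [D DE] := coordinate_covectors.
apply: (omega_f_linear_type f p V e
  [tuple - D 2%N; - D 4%N; D 5%N; D 1%N; D 3%N; D 6%N]) => // psi h w.
change (wedge3 e 1 5 6 (psi \o w) - wedge3 e 2 4 6 (psi \o w)
  + wedge3 e 3 4 5 (psi \o w) = omega_f f p w).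
rewrite !(pullback_wedge3 _ _ _ _ _ _ _ _ _ _ _ h) omega_fE !wedge3E /minor3 /=.
rewrite !(opp_lfunE, DE) // fp.
by ring.
Qed.

End LinearTypes.

End LinearAlgebra.

Theorem proposition2p3 (R : realType) (f : 'rV[R]_6 -> R^o) (hf : smooth f) :
  (depends_only_on [:: 2; 4; 5]%N f -> multisymplectic (omega_f f)) /\
  (forall (V : vectType R) (hV : \dim {:V} = 6%N)
      (e : 6.-tuple 'Hom(V, R^o)) (he : basis_of fullv e) (p : 'rV[R]_6),
    [/\ 0 < f p -> same_linear_type (omega_f f p) (alpha_i e),
        f p < 0 -> same_linear_type (omega_f f p) (alpha_ii e) &
        f p = 0 -> same_linear_type (omega_f f p) (alpha_iii e)]).
Proof.
split=> [f245|V dV e be p].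
  split; [exact: omega_f_smooth| |exact: omega_f_nondegenerate].
  by apply: omega_f_closed => //; exact: (hf [::]).
by split; [exact: linear_type_pos | exact: linear_type_neg
          | exact: linear_type_zero].
Qed.
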